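(* We have (a) $$\frac{1}{1-t}+\sum_{n=1}^\infty\frac{(1+t^2)^n}{2(1-t)^2(1-t^2)^{n-1}}P_n^{(\mathrm{udr},\mathrm{fix})}\left(\frac{2t}{1+t^2},z\right)x^n=\sum_{k=0}^\infty\frac{(1+zx)^k}{(1-zx)^k}\frac{(1-x)^k}{(1+x)^k}t^{2k}\left(\frac{1}{1-2kx}+\frac{1-x}{1-zx}\frac{t}{1-(2k+1)x}\right)$$ and (b) $$\frac{1}{1-t}+\sum_{n=1}^\infty\frac{(1+t^2)^n}{2(1-t)^2(1-t^2)^{n-1}}D_n^{\mathrm{udr}}\left(\frac{2t}{1+t^2}\right)x^n=\sum_{k=0}^\infty\frac{(1-x)^k}{(1+x)^k}t^{2k}\left(\frac{1}{1-2kx}+\frac{(1-x)t}{1-(2k+1)x}\right).$$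
   Context: For a permutation $\pi=\pi(1)\cdots\pi(n)$ of $[n]=\{1,\dots,n\}$, a birun is a maximal monotone consecutive subsequence of $\pi$, and an up-down run is a birun of $\pi$, or the single letter $\pi(1)$ if $\pi(1)>\pi(2)$; $\mathrm{udr}(\pi)$ is the number of up-down runs (equal to $1$ for the permutation of length $1$; e.g. $71462853$ has up-down runs $7,71,146,62,28,853$). $\mathrm{fix}(\pi)$ is the number of fixed points. $\mathfrak{S}_n$ is the set of all permutations of $[n]$ and $\mathfrak{D}_n$ is the set of derangements of $[n]$ (permutations with no fixed points). Put $$P_n^{(\mathrm{udr},\mathrm{fix})}(t,z)=\sum_{\pi\in\mathfrak{S}_n}t^{\mathrm{udr}(\pi)}z^{\mathrm{fix}(\pi)},\qquad D_n^{\mathrm{udr}}(t)=\sum_{\pi\in\mathfrak{D}_n}t^{\mathrm{udr}(\pi)}.$$ The identities are between formal power series in $x$ and $t$; rational functions of $t$ are expanded as power series in $t$. *)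

(* Defs.v *)
From HB Require Import structures.
From mathcomp Require Import all_boot all_order all_fingroup all_algebra.
From mathcomp Require Import boolp.

Set Implicit Arguments.
Unset Strict Implicit.
Unset Printing Implicit Defensive.

Import GRing.Theory.
Local Open Scope ring_scope.

(* Formal power series in one variable; [f n] is the coefficient of degree n.
   Bivariate series in x and t are [fps (fps R)]: series in x whose
   coefficients are series in t. *)
Record fps (R : Type) := FPS { fps_coef :> nat -> R }.

HB.instance Definition _ (R : Type) := [isNew for @fps_coef R].
HB.instance Definition _ (R : choiceType) := [Equality of fps R by <:].
HB.instance Definition _ (R : choiceType) := [Choice of fps R by <:].

Lemma fpsP (R : Type) (f g : fps R) : (forall n, f n = g n) <-> f = g.
Proof.
split=> [|-> //]; case: f g => [f] [g] /= fg.
by congr FPS; apply/funext.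
Qed.

Section FPSZmodule.
Variable R : zmodType.
Implicit Types f g h : fps R.

Definition fps_zero : fps R := FPS (fun=> 0).
Definition fps_opp f : fps R := FPS (fun n => - f n).
Definition fps_add f g : fps R := FPS (fun n => f n + g n).

Fact fps_addA : associative fps_add.
Proof. by move=> f g h; apply/fpsP => n /=; rewrite addrA. Qed.
Fact fps_addC : commutative fps_add.
Proof. by move=> f g; apply/fpsP => n /=; rewrite addrC. Qed.
Fact fps_add0 : left_id fps_zero fps_add.
Proof. by move=> f; apply/fpsP => n /=; rewrite add0r. Qed.
Fact fps_addN : left_inverse fps_zero fps_opp fps_add.
Proof. by move=> f; apply/fpsP => n /=; rewrite addNr. Qed.

HB.instance Definition _ :=
  GRing.isZmodule.Build (fps R) fps_addA fps_addC fps_add0 fps_addN.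

Lemma fps_coef0 n : (0 : fps R) n = 0. Proof. by []. Qed.
Lemma fps_coefD f g n : (f + g) n = f n + g n. Proof. by []. Qed.
Lemma fps_coefN f n : (- f) n = - f n. Proof. by []. Qed.

Lemma fps_coef_sum (I : Type) (r : seq I) (P : pred I) (F : I -> fps R) n :
  (\sum_(i <- r | P i) F i) n = \sum_(i <- r | P i) F i n.
Proof. by apply: (big_morph (fun f : fps R => f n)). Qed.
End FPSZmodule.

Section FPSRing.
Variable R : comNzRingType.
Implicit Types f g h : fps R.

Definition fpsC (a : R) : fps R := FPS (fun n => if n == 0%N then a else 0).
Definition fpsX : fps R := FPS (fun n => (n == 1%N)%:R).
Definition fps_mul f g : fps R :=
  FPS (fun n => \sum_(i < n.+1) f i * g (n - i)%N).

Let trunc n f : {poly R} := \poly_(i < n.+1) f i.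

Let coef_trunc n f i : (i <= n)%N -> (trunc n f)`_i = f i.
Proof. by rewrite coef_poly ltnS => ->. Qed.

Let coef_mul_trunc n f g i :
  (i <= n)%N -> (fps_mul f g) i = (trunc n f * trunc n g)`_i.
Proof.
move=> le_in; rewrite coefM; apply: eq_bigr => j _.
rewrite !coef_trunc // (leq_trans _ le_in) ?leq_subr //.
by rewrite -ltnS.
Qed.

Fact fps_mulC : commutative fps_mul.
Proof.
by move=> f g; apply/fpsP => n; rewrite !(@coef_mul_trunc n) // mulrC.
Qed.

Fact fps_mulA : associative fps_mul.
Proof.
move=> f g h; apply/fpsP => n.
transitivity ((trunc n f * trunc n g * trunc n h)`_n).
  rewrite -mulrA coefM; apply: eq_bigr => i _.
  rewrite (@coef_mul_trunc n) ?leq_subr // coef_trunc //.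
  by rewrite -ltnS.
rewrite coefM; apply: eq_bigr => i _.
rewrite -(@coef_mul_trunc n) ?coef_trunc ?leq_subr //.
by rewrite -ltnS.
Qed.

Fact fps_mul1 : left_id (fpsC 1) fps_mul.
Proof.
move=> f; apply/fpsP => n /=.
rewrite big_ord_recl /= mul1r subn0 big1 ?addr0 // => i _.
by rewrite mul0r.
Qed.

Fact fps_mulDl : left_distributive fps_mul +%R.
Proof.
move=> f g h; apply/fpsP => n /=.
by rewrite -big_split; apply: eq_bigr => i _; rewrite mulrDl.
Qed.

Fact fps_oner_neq0 : fpsC 1 != 0.
Proof. by apply/eqP => /fpsP/(_ 0%N) /eqP; rewrite oner_eq0. Qed.

HB.instance Definition _ := GRing.Zmodule_isComNzRing.Build (fps R)
  fps_mulA fps_mulC fps_mul1 fps_mulDl fps_oner_neq0.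

Lemma fps_coef1 n : (1 : fps R) n = (n == 0%N)%:R.
Proof. by rewrite [LHS]/=; case: eqP. Qed.

Lemma fps_coefM f g n : (f * g) n = \sum_(i < n.+1) f i * g (n - i)%N.
Proof. by []. Qed.

Fact fpsC_is_zmod_morphism : zmod_morphism fpsC.
Proof. by move=> a b; apply/fpsP => -[|n] //=; rewrite subr0. Qed.

Fact fpsC_is_monoid_morphism : monoid_morphism fpsC.
Proof.
split=> // a b; apply/fpsP => n; rewrite fps_coefM big_ord_recl subn0 /=.
rewrite big1 => [|i _]; last by rewrite mul0r.
by rewrite addr0; case: n => //= n; rewrite mulr0.
Qed.

HB.instance Definition _ :=
  GRing.isZmodMorphism.Build R (fps R) fpsC fpsC_is_zmod_morphism.
HB.instance Definition _ :=
  GRing.isMonoidMorphism.Build R (fps R) fpsC fpsC_is_monoid_morphism.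
End FPSRing.

Section FPSUnitRing.
Variable R : comUnitRingType.
Implicit Types f g : fps R.

Definition fps_unit : pred (fps R) := fun f => f 0%N \is a GRing.unit.

(* First n coefficients of the inverse, by the recurrence
   g_0 = 1 / f_0 and g_m = - (sum_(i < m) g_i f_(m - i)) / f_0. *)
Fixpoint fps_inv_seq f (n : nat) : seq R :=
  if n is m.+1 then
    let s := fps_inv_seq f m in
    rcons s (((m == 0%N)%:R - \sum_(i < m) s`_i * f (m - i)%N) / f 0%N)
  else [::].

(* As usual for unit rings, the inverse of a non-unit is itself. *)
Definition fps_inv f : fps R :=
  if fps_unit f then FPS (fun n => (fps_inv_seq f n.+1)`_n) else f.

Let size_inv_seq f n : size (fps_inv_seq f n) = n.
Proof. by elim: n => //= n IHn; rewrite size_rcons IHn. Qed.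

Let nth_inv_seq f n i :
  (i < n)%N -> (fps_inv_seq f n)`_i = (fps_inv_seq f i.+1)`_i.
Proof.
elim: n => // n IHn; rewrite ltnS leq_eqVlt => /predU1P[-> //|lt_in].
by rewrite [LHS]nth_rcons size_inv_seq lt_in IHn.
Qed.

Fact fps_mulV : {in fps_unit, left_inverse 1 fps_inv *%R}.
Proof.
move=> f Uf; apply/fpsP => n; rewrite fps_coef1 fps_coefM /fps_inv (Uf : fps_unit f).
rewrite big_ord_recr subnn /=.
rewrite [X in _ + X * _]nth_rcons size_inv_seq ltnn eqxx divrK //.
rewrite (eq_bigr (fun i : 'I_n => (fps_inv_seq f n)`_i * f (n - i)%N)).
  by rewrite addrC subrK.
by move=> i _; rewrite (nth_inv_seq _ (ltn_ord i)).
Qed.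

Fact fps_unitP f g : g * f = 1 -> fps_unit f.
Proof.
move=> /fpsP/(_ 0%N); rewrite fps_coefM big_ord_recl big_ord0 addr0 subn0.
by move=> gf; apply/unitrPr; exists (g 0%N); rewrite mulrC.
Qed.

Fact fps_inv_out : {in [predC fps_unit], fps_inv =1 id}.
Proof. by move=> f /negPf Uf; rewrite /fps_inv -[fps_unit f]/(f \in fps_unit) Uf. Qed.

HB.instance Definition _ := GRing.ComNzRing_hasMulInverse.Build (fps R)
  fps_mulV fps_unitP fps_inv_out.

Lemma fps_unitE f : (f \is a GRing.unit) = (f 0%N \is a GRing.unit).
Proof. by []. Qed.
End FPSUnitRing.

(* [fps2_sum m F S]: the series sum_(k >= m) F k of elements of R[[t]][[x]]
   converges to S, i.e. each coefficient [x^i t^j] of its partial sums is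
   eventually equal to that of S. *)
Definition fps2_sum (R : zmodType) (m : nat) (F : nat -> fps (fps R))
    (S : fps (fps R)) : Prop :=
  forall i j : nat, exists N : nat, forall n : nat, (N <= n)%N ->
    (\sum_(m <= k < n) F k) i j = S i j.

Lemma fps2_sum_unique (R : zmodType) m (F : nat -> fps (fps R)) S T :
  fps2_sum m F S -> fps2_sum m F T -> S = T.
Proof.
move=> FS FT; apply/fpsP => i; apply/fpsP => j.
have [N SN] := FS i j; have [M TM] := FT i j.
by rewrite -(SN (maxn N M)) ?leq_maxl // -(TM (maxn N M)) ?leq_maxr.
Qed.

Section PermStat.
Variable n : nat.
Implicit Types (s : 'S_n) (I J : 'I_n * 'I_n).

(* Nonempty consecutive subsequences of s(0) ... s(n-1) are represented by
   the pair of their first and last positions. *)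
Definition increasing_on s I : bool :=
  [forall a : 'I_n, forall b : 'I_n,
     [&& I.1 <= a, a < b & b <= I.2]%N ==> (s a < s b)%N].

Definition decreasing_on s I : bool :=
  [forall a : 'I_n, forall b : 'I_n,
     [&& I.1 <= a, a < b & b <= I.2]%N ==> (s b < s a)%N].

Definition monotone_on s I : bool :=
  (I.1 <= I.2)%N && (increasing_on s I || decreasing_on s I).

Definition birun s I : bool :=
  monotone_on s I &&
  [forall J : 'I_n * 'I_n,
     [&& J.1 <= I.1, I.2 <= J.2 & monotone_on s J]%N ==> (J == I)].

Definition initial_descent s : bool :=
  [exists a : 'I_n, exists b : 'I_n,
     [&& a == 0 :> nat, b == 1 :> nat & s b < s a]%N].

Definition updown_run s I : bool :=
  birun s I || [&& I.1 == 0 :> nat, I.2 == 0 :> nat & initial_descent s]%N.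

Definition udr s : nat := #|[set I | updown_run s I]|.

Definition fixpt s : nat := #|[set i | s i == i]|.

Definition derangement s : bool := [forall i, s i != i].
End PermStat.

(* The polynomial variable of [{poly {poly rat}}] is t, that of [{poly rat}]
   is z. *)
Definition P_udr_fix (n : nat) : {poly {poly rat}} :=
  \sum_(s : 'S_n) ('X^(fixpt s))%:P * 'X^(udr s).

Definition D_udr (n : nat) : {poly rat} :=
  \sum_(s : 'S_n | derangement s) 'X^(udr s).

(* Constants, x and t in R[[t]][[x]]. *)
Definition fps2C (R : comNzRingType) (a : R) : fps (fps R) := fpsC (fpsC a).
Definition xvar (R : comNzRingType) : fps (fps R) := fpsX (fps R).
Definition tvar (R : comNzRingType) : fps (fps R) := fpsC (fpsX R).

(* Evaluation at u of a polynomial over R, for u in R[[t]][[x]]. *)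
Definition fps2_eval (R : comNzRingType) (p : {poly R}) (u : fps (fps R)) :
    fps (fps R) := (map_poly (@fps2C R) p).[u].

(* Main.v *)
Require Import Defs.
From HB Require Import structures.
From mathcomp Require Import all_boot all_order all_fingroup all_algebra.
From mathcomp Require Import zify ring.

(** Letters are the naturals below N; a word w of length n over them is sorted
    stably, except that the positions of an odd letter are listed in
    decreasing order.  Sorting turns the words into the pairs (s, f) of a
    permutation s and a weakly increasing f such that s increases on the blocks
    where f takes a given even value and decreases on those where f takes a
    given odd value.  The sum of z^fix(s) over these pairs is computed twice;
    it is the coefficient of t^N x^n on both sides of the identity.

    For the left side, fix s and sum t^N times the number of admissible f over
    N.  Whether f may stay constant from i to i+1 depends only on the parity of
    f i and on whether s ascends or descends there, so a two-state transfer
    matrix gives this generating function ([chain_count_series]): apart from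
    fixed factors, each step contributes 1 + t^2 if it repeats the direction of
    the previous step and 2t if it changes it, with a virtual ascent in front.
    The number of changes of direction is udr(s) - 1, since the last positions
    of the up-down runs are the positions where the direction changes,
    together with the last one ([udr_changes]).

    For the right side, consider the insertion of one new letter c into a word
    w in such a way that the new position is a fixed point of the sorting
    permutation.  Such an insertion neither creates nor destroys other fixed
    points, and if r fixed points of w carry the letter c, it is possible in
    1 + r ways for an even c and in 1 - r ways for an odd one
    ([insertions_even], [insertions_odd]).  Counting words with a marked fixed
    point then gives recurrences ([word_count_even], [word_count_odd]) whose
    solution says that each even letter contributes 1/(1 - zx) and each odd
    letter 1 + zx to the generating function of all words, relative to that of
    the words without fixed points ([word_series_factor]).  At z = 1 all words
    are counted, which gives 1/(1 - Nx) and determines the fixed-point-free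
    factor ([word_seriesE]).

    Part (b) is the value at z = 0 of this computation. *)

Set Implicit Arguments.
Unset Strict Implicit.
Unset Printing Implicit Defensive.

Import GRing.Theory.

(** * Sorting words and inserting fixed points *)

Section Words.
Variable N : nat.

Section Rank.
Variables (n : nat) (w : {ffun 'I_n -> 'I_N}).
Implicit Types u v : 'I_n.

Definition prec u v : bool :=
  if w u == w v then (if odd (w u) then v < u else u < v) else w u < w v.

(** The place of v in the sorted list of positions: rank is the inverse of the
    sorting permutation, so v is fixed by that permutation iff rank v = v. *)
Definition rank v : nat := \sum_u prec u v.

Lemma prec_irr u : prec u u = false.
Proof. by rewrite /prec eqxx ltnn if_same. Qed.

Lemma prec_trans : transitive prec.
Proof.
move=> v u x; rewrite /prec; case: (eqVneq (w u) (w v)) => [->|uv].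
  by case: eqP => // _; case: odd; lia.
case: (eqVneq (w v) (w x)) => [<-|vx]; first by rewrite (negbTE uv).
by case: (eqVneq (w u) (w x)) => [->|_]; lia.
Qed.

Lemma prec_total u v : u != v -> prec u v = ~~ prec v u.
Proof.
rewrite -val_eqE /prec [w v == w u]eq_sym /= => neq.
case: (eqVneq (w u) (w v)) => [->|]; first by case: odd; lia.
by rewrite -val_eqE /=; lia.
Qed.

Lemma rank_homo u v : prec u v -> rank u < rank v.
Proof.
move=> uv; rewrite /rank (bigD1 u) //= [X in _ < X](bigD1 u) //= prec_irr uv.
rewrite add0n add1n ltnS; apply: leq_sum => x _.
by case xu: (prec x u) => //; rewrite (prec_trans xu uv).
Qed.

Lemma precE u v : prec u v = (rank u < rank v).
Proof.
have [->|neq] := eqVneq u v; first by rewrite prec_irr ltnn.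
apply/idP/idP => [/rank_homo //|]; apply: contraLR => nuv.
by rewrite -leqNgt ltnW // rank_homo // prec_total // eq_sym.
Qed.

Lemma rank_inj : injective rank.
Proof.
move=> u v e; apply/eqP; apply/negPn/negP => neq.
by have := prec_total neq; rewrite !precE e ltnn.
Qed.

Lemma rank_lt v : rank v < n.
Proof.
rewrite -[X in _ < X]card_ord -sum1_card /rank (bigD1 v) //= prec_irr.
rewrite [X in _ < X](bigD1 v) //= add0n add1n ltnS.
by apply: leq_sum => x _; case: prec.
Qed.

Definition fixed_letter (c : 'I_N) : nat :=
  \sum_u ((w u == c) && (rank u == u)).

(** Fixed points are separated by the parity of their letter because the two
    kinds of letters obey different insertion counts. *)
Definition fixed_sign (o : bool) : nat :=
  \sum_u ((odd (w u) == o) && (rank u == u)).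

Lemma fixed_sign_letters o :
  fixed_sign o = \sum_(c : 'I_N | odd c == o) fixed_letter c.
Proof.
rewrite exchange_big; apply: eq_bigr => u _ /=.
rewrite big_mkcond (bigD1 (w u)) //= eqxx big1 ?addn0 => [|c].
  by case: eqP.
by rewrite eq_sym => /negPf ->; case: ifP.
Qed.
End Rank.

Section Insertion.
Variables (n : nat) (p : 'I_n.+1) (c : 'I_N).

Definition ins (w : {ffun 'I_n -> 'I_N}) : {ffun 'I_n.+1 -> 'I_N} :=
  [ffun u => if unlift p u is Some v then w v else c].

Lemma ins_at w : ins w p = c. Proof. by rewrite ffunE unlift_none. Qed.

Lemma ins_lift w u : ins w (lift p u) = w u.
Proof. by rewrite ffunE liftK. Qed.
End Insertion.

Lemma sum_ins (R : nmodType) n (p : 'I_n.+1) (F : {ffun 'I_n.+1 -> 'I_N} -> R) :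
  (\sum_w F w = \sum_c \sum_w F (ins p c w))%R.
Proof.
rewrite pair_big /= (reindex (fun x => ins p x.1 x.2)) //=.
exists (fun w => (w p, [ffun u => w (lift p u)])) => [[c w]|w] _ /=.
  by rewrite ins_at; congr pair; apply/ffunP => u; rewrite ffunE ins_lift.
apply/ffunP => u; rewrite ffunE.
by case: unliftP => [v ->|->] //; rewrite ffunE.
Qed.

Lemma prec_ins n (p : 'I_n.+1) c w u v :
  prec (ins p c w) (lift p u) (lift p v) = prec w u v.
Proof.
rewrite /prec !ins_lift.
have E (x y : 'I_n) : (lift p x < lift p y) = (x < y).
  by rewrite /= /bump; lia.
by rewrite !E.
Qed.

Lemma rank_ins_lift n (p : 'I_n.+1) c w u :
  rank (ins p c w) (lift p u) = prec (ins p c w) p (lift p u) + rank w u.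
Proof.
rewrite /rank (bigD1_ord p) //=; congr (_ + _).
by apply: eq_bigr => v _; rewrite prec_ins.
Qed.

(** When the inserted position is fixed, deleting it removes the same number
    from the positions and from the ranks; both are then renumbered in the same
    way, so equality of position and rank survives. *)
Lemma fixed_ins_lift n (p : 'I_n.+1) c w u : rank (ins p c w) p == p ->
  (rank (ins p c w) (lift p u) == lift p u) = (rank w u == u).
Proof.
move=> /eqP fp; have := rank_ins_lift p c w u; rewrite precE fp.
have : rank (ins p c w) (lift p u) != p.
  apply: contraNneq (neq_lift p u) => e; apply/eqP/(@rank_inj _ (ins p c w)).
  by rewrite fp.
by rewrite /= /bump; lia.
Qed.

Lemma fixed_sign_ins n (p : 'I_n.+1) c w o : rank (ins p c w) p == p ->
  fixed_sign (ins p c w) o = (odd c == o) + fixed_sign w o.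
Proof.
move=> fp; rewrite /fixed_sign (bigD1_ord p) //= ins_at fp andbT.
by congr (_ + _); apply: eq_bigr => u _; rewrite ins_lift fixed_ins_lift.
Qed.

Section Insertions.
Variables (n : nat) (c : 'I_N) (w : {ffun 'I_n -> 'I_N}).
Let smaller := \sum_u (w u < c).
(* Indexed by nat so that prefix sums can be treated by induction. *)
Let q (i : nat) : bool := if insub i is Some u then w u == c else false.

Let qE (u : 'I_n) : q u = (w u == c). Proof. by rewrite /q valK. Qed.

Let sum_q_lt (m : 'I_n.+1) : \sum_(u : 'I_n) (q u && (u < m)) = \sum_(i < m) q i.
Proof.
rewrite (big_ord_widen n (fun i => q i : nat) (leq_ord m)) [RHS]big_mkcond /=.
by apply: eq_bigr => u _; case: q; case: ltnP.
Qed.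

(** Inserting c at p makes p fixed iff L + Q p = p, where L counts the smaller
    letters of w and Q p the letters c before p.  As p grows by one, L + Q p - p
    stays constant at a letter c and drops by one elsewhere, so the solutions
    form an interval.  All but the last of them are occurrences of c, and those
    are the fixed points of w with letter c. *)
Lemma insertions_even : ~~ odd c ->
  \sum_p (rank (ins p c w) p == p) = (fixed_letter w c).+1.
Proof.
move=> oc.
pose Q m := \sum_(i < m) q i.
have rp (p : 'I_n.+1) : rank (ins p c w) p = smaller + Q p.
  rewrite /rank (bigD1_ord p) //= prec_irr add0n /Q -sum_q_lt -big_split /=.
  apply: eq_bigr => u _; rewrite qE /prec ins_at ins_lift.
  rewrite -val_eqE /= /bump; case: eqP => [->|]; last by lia.
  by rewrite (negPf oc); lia.
have ru (u : 'I_n) : w u == c -> rank w u = smaller + Q u.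
  move=> wu; rewrite /rank /Q -(sum_q_lt (widen_ord (leqnSn n) u)) -big_split /=.
  apply: eq_bigr => v _; rewrite qE /prec (eqP wu).
  rewrite -val_eqE /=; case: eqP => [->|]; last by lia.
  by rewrite (negPf oc); lia.
(* Truncation at m makes the count inductive: the last term says whether
   L + Q p - p has already come down to zero. *)
have key m : \sum_(p < m.+1) (smaller + Q p == p)
    = \sum_(u < m) (q u && (smaller + Q u == u)) + (smaller + Q m <= m).
  elim: m => [|m IH].
    by rewrite big_ord_recr !big_ord0 /= /Q big_ord0; lia.
  rewrite big_ord_recr IH [in RHS]big_ord_recr /=.
  by rewrite /Q !big_ord_recr /=; case: (q m); lia.
under eq_bigr => p do rewrite rp.
rewrite key addnC -add1n; congr (_ + _).
  suff -> : smaller + Q n <= n by [].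
  rewrite /Q -(sum_q_lt ord_max) -big_split /= -[X in _ <= X]card_ord -sum1_card.
  by apply: leq_sum => u _; rewrite qE -val_eqE /=; lia.
by apply: eq_bigr => u _; rewrite qE; case wu: (w u == c) => //=; rewrite ru.
Qed.

(** With decreasing blocks the condition for p reads K = p + Q p, where K counts
    the letters of w that are at most c.  The right side grows by one or two,
    and it jumps over K exactly at a fixed point with letter c.  So the
    equation has a solution iff there is no such fixed point, and there is at
    most one. *)
Lemma insertions_odd : odd c ->
  \sum_p (rank (ins p c w) p == p) + fixed_letter w c = 1.
Proof.
move=> oc.
pose Q m := \sum_(i < m) q i.
have total (m : 'I_n.+1) : \sum_(u : 'I_n) (q u && (m <= u)) + Q m = Q n.
  rewrite /Q -sum_q_lt -(sum_q_lt ord_max) -big_split /=; apply: eq_bigr => u _.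
  by rewrite ltn_ord; case: q; lia.
have rp (p : 'I_n.+1) : rank (ins p c w) p + Q p = smaller + Q n.
  rewrite -(total p) addnA; congr (_ + _).
  rewrite /rank (bigD1_ord p) //= prec_irr add0n -big_split /=.
  apply: eq_bigr => u _; rewrite qE /prec ins_at ins_lift.
  rewrite -val_eqE /= /bump; case: eqP => [->|]; last by lia.
  by rewrite oc; lia.
have ru (u : 'I_n) : w u == c -> rank w u + Q u.+1 = smaller + Q n.
  move=> wu; rewrite -(total (lift ord0 u)) addnA; congr (_ + _).
  rewrite /rank -big_split /=.
  apply: eq_bigr => v _; rewrite qE /prec (eqP wu).
  rewrite -val_eqE /=; case: eqP => [->|]; last by lia.
  by rewrite oc /bump; lia.
(* Hits and jumps below m together tell whether K has been reached by m. *)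
have key m : \sum_(p < m.+1) (smaller + Q n == p + Q p)
    + \sum_(u < m) (q u && (smaller + Q n == u + Q u.+1))
    = (smaller + Q n <= m + Q m).
  elim: m => [|m IH].
    by rewrite big_ord_recr !big_ord0 /= /Q big_ord0; lia.
  rewrite big_ord_recr [X in _ + X = _]big_ord_recr /= addnACA IH.
  by move: (smaller + Q n) => K; rewrite /Q !big_ord_recr /=; case: (q m); lia.
transitivity (smaller + Q n <= n + Q n : nat).
  rewrite -key; congr (_ + _); apply: eq_bigr => u _; first by have := rp u; lia.
  by rewrite qE; case wu: (w u == c) => //=; have := ru u wu; lia.
suff : smaller <= n by lia.
rewrite -[X in _ <= X]card_ord -sum1_card.
by apply: leq_sum => u _; case: ltnP.
Qed.
End Insertions.
End Words.

(** * Counting words by fixed points *)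

Section FixedCount.
Variable N : nat.

Definition word_count n i j : nat :=
  \sum_(w : {ffun 'I_n -> 'I_N})
     ((fixed_sign w false == i) && (fixed_sign w true == j)).

Definition letters o : nat := \sum_(c : 'I_N) (odd c == o).

(** Double counting of words with a marked fixed point of parity o: deleting the
    marked position leaves a word together with an insertion.  The weight phi
    carries the numbers of fixed points through this correspondence. *)
Lemma sum_marked n o (phi : nat -> nat -> nat) :
  \sum_(w : {ffun 'I_n.+1 -> 'I_N})
     fixed_sign w o * phi (fixed_sign w false) (fixed_sign w true)
  = \sum_(w : {ffun 'I_n -> 'I_N})
     (\sum_(c : 'I_N | odd c == o) \sum_p (rank (ins p c w) p == p))
     * phi (~~ o + fixed_sign w false) (o + fixed_sign w true).
Proof.
under eq_bigr => w _ do rewrite {1}/fixed_sign big_distrl.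
rewrite exchange_big /=.
under eq_bigr => p _ do rewrite (sum_ins p).
under [RHS]eq_bigr => w _.
  rewrite big_distrl /=; under eq_bigr => c _ do rewrite big_distrl /=.
  over.
rewrite exchange_big /= [RHS]exchange_big /= [RHS]big_mkcond /=.
apply: eq_bigr => c _; case: ifP => [oc|/negbT noc].
  rewrite [RHS]exchange_big /=; apply: eq_bigr => p _; apply: eq_bigr => w _.
  rewrite ins_at oc /=; case fp: (_ == _); rewrite ?mul0n // !mul1n.
  rewrite !fixed_sign_ins // (eqP oc).
  by case: (o).
rewrite big1 // => p _; rewrite big1 // => w _.
by rewrite ins_at (negPf noc).
Qed.

Lemma word_count_even n i j :
  i.+1 * word_count n.+1 i.+1 j = (letters false + i) * word_count n i j.
Proof.
have := sum_marked n false (fun x y => (x == i.+1) && (y == j)).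
rewrite /word_count !big_distrr /= => H.
etransitivity; first etransitivity; [|exact: H|]; apply: eq_bigr => w _.
  by case: eqP => [->|]; rewrite ?muln0.
rewrite add1n add0n eqSS; case: (eqVneq _ i) => [<-|]; last by rewrite !muln0.
congr (_ * _); rewrite fixed_sign_letters /letters big_mkcond /=.
rewrite [X in _ = _ + X]big_mkcond -big_split /=; apply: eq_bigr => c _.
by case oc: (odd c); rewrite //= insertions_even ?oc // add1n.
Qed.

Lemma word_count_odd n i j :
  j.+1 * word_count n.+1 i j.+1 = (letters true - j) * word_count n i j.
Proof.
have := sum_marked n true (fun x y => (x == i) && (y == j.+1)).
rewrite mulnBl /word_count => H; apply/eqP.
rewrite eq_sym -(eqn_add2r (j * word_count n i j)).
rewrite subnK; last first.
  rewrite /word_count !big_distrr /=; apply: leq_sum => w _.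
  case: (eqVneq _ j) => [<-|]; last by rewrite andbF muln0.
  rewrite leq_mul2r; apply/orP; right.
  rewrite fixed_sign_letters /letters big_mkcond; apply: leq_sum => c _.
  case: eqP => //= oc; have := insertions_odd w oc; lia.
apply/eqP; rewrite /word_count !big_distrr /=.
transitivity (\sum_(w : {ffun 'I_n.+1 -> 'I_N}) fixed_sign w true *
  ((fixed_sign w false == i) && (fixed_sign w true == j.+1)) +
   \sum_(w : {ffun 'I_n -> 'I_N})
      j * ((fixed_sign w false == i) && (fixed_sign w true == j))).
  rewrite H -big_split /=; apply: eq_bigr => w _.
  rewrite add1n add0n eqSS; case: (eqVneq _ j) => [<-|]; last by rewrite !andbF !muln0.
  rewrite -mulnDl; congr (_ * _); rewrite fixed_sign_letters /letters.
  rewrite big_mkcond /= [X in _ = X + _]big_mkcond [X in _ = _ + X]big_mkcond.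
  rewrite -big_split /=.
  by apply: eq_bigr => c _; case oc: (odd c) => //=; rewrite insertions_odd.
congr (_ + _); apply: eq_bigr => w _.
by case: (eqVneq _ j.+1) => [->|]; rewrite ?andbF ?muln0.
Qed.

(** The recurrences remove one fixed point at a time, down to words without any.
    The letters of the fixed points thus behave like a multiset of even letters
    and a set of odd ones, chosen independently of the rest of the word. *)
Lemma word_countE m i j :
  word_count (i + (j + m)) i j
  = 'C((letters false + i).-1, i) * ('C(letters true, j) * word_count m 0 0).
Proof.
elim: i => [|i IHi].
  rewrite add0n addn0 bin0 mul1n; elim: j => [|j IHj]; first by rewrite bin0 mul1n.
  apply/eqP; rewrite -(eqn_pmul2l (ltn0Sn j)) addSn word_count_odd IHj.
  by rewrite mulnA -mul_bin_left -mulnA.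
apply/eqP; rewrite -(eqn_pmul2l (ltn0Sn i)) addSn word_count_even IHi.
by rewrite mulnA addnS mul_bin_diag -!mulnA.
Qed.

Lemma fixed_sign_le n (w : {ffun 'I_n -> 'I_N}) :
  fixed_sign w false + fixed_sign w true <= n.
Proof.
rewrite -[X in _ <= X]card_ord -sum1_card -big_split /=.
by apply: leq_sum => u _; case: (odd _); case: (rank _ _ == _ :> nat).
Qed.

Lemma lettersE : (letters false = uphalf N) * (letters true = N./2).
Proof.
rewrite /letters; elim: N => [|k [IH1 IH2]]; first by rewrite !big_ord0.
by rewrite !big_ord_recr /= IH1 IH2; split; lia.
Qed.
End FixedCount.

Section Series.
Local Open Scope ring_scope.
Variable R : comUnitRingType.
Implicit Types (f g : fps R) (a z : R).

Lemma coef_fpsCM a f n : (fpsC a * f) n = a * f n.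
Proof.
rewrite fps_coefM big_ord_recl subn0 /= big1 ?addr0 // => i _.
by rewrite mul0r.
Qed.

Lemma coef_fpsXM f n : (fpsX R * f) n = if n is m.+1 then f m else 0.
Proof.
rewrite fps_coefM big_ord_recl mul0r add0r; case: n => [|n]; first by rewrite big_ord0.
rewrite big_ord_recl mul1r subn1 big1 ?addr0 // => i _.
by rewrite mul0r.
Qed.

Definition binomial_series k z : fps R := FPS (fun j => 'C(k, j)%:R * z ^+ j).

Definition multiset_series k z : fps R :=
  FPS (fun i => 'C((k + i).-1, i)%:R * z ^+ i).

Lemma binomial_seriesE k z : binomial_series k z = (1 + fpsC z * fpsX R) ^+ k.
Proof.
elim: k => [|k IH].
  by apply/fpsP => -[|j]; rewrite fps_coef1 /= ?mulr1 ?mul0r.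
rewrite exprS -IH mulrDl mul1r -mulrA; apply/fpsP => j.
rewrite fps_coefD coef_fpsCM coef_fpsXM.
case: j => [|j] /=; first by rewrite !bin0 mulr0 addr0.
by rewrite binS natrD exprS; ring.
Qed.

(** Stated as a product rather than a quotient so that the induction on k is
    Pascal's rule. *)
Lemma multiset_seriesE k z :
  multiset_series k z * (1 - fpsC z * fpsX R) ^+ k = 1.
Proof.
elim: k => [|k IH].
  rewrite expr0 mulr1; apply/fpsP => -[|i]; rewrite fps_coef1 /= ?mulr1 //.
  by rewrite bin_small // mul0r.
rewrite exprS mulrA -[RHS]IH; congr (_ * _); rewrite mulrC mulrBl mul1r -mulrA.
apply/fpsP => i; rewrite fps_coefD fps_coefN coef_fpsCM coef_fpsXM.
case: i => [|i] /=; first by rewrite mulr0 subr0 !bin0.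
by rewrite addnS /= binS natrD exprS; ring.
Qed.

Lemma unit_1subM f : 1 - f * fpsX R \is a GRing.unit.
Proof.
by rewrite fps_unitE fps_coefD fps_coefN mulrC coef_fpsXM subr0 unitr1.
Qed.

Lemma unit_1addM f : 1 + f * fpsX R \is a GRing.unit.
Proof. by rewrite -[f]opprK mulNr unit_1subM. Qed.

Variable N : nat.

Definition num_fixed n (w : {ffun 'I_n -> 'I_N}) : nat :=
  (\sum_u (rank w u == u))%N.

Lemma num_fixed_sign n (w : {ffun 'I_n -> 'I_N}) :
  num_fixed w = (fixed_sign w false + fixed_sign w true)%N.
Proof.
rewrite -big_split /=; apply: eq_bigr => u _.
by case: odd; case: (_ == _ :> nat).
Qed.

Definition word_series z : fps R :=
  FPS (fun n => \sum_(w : {ffun 'I_n -> 'I_N}) z ^+ num_fixed w).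

Definition fixfree_series : fps R := FPS (fun n => (word_count N n 0 0)%:R).

Lemma word_series_factor z :
  word_series z
  = multiset_series (uphalf N) z * (binomial_series N./2 z * fixfree_series).
Proof.
apply/fpsP => n; rewrite fps_coefM.
transitivity (\sum_(i < n.+1) \sum_(j < (n - i).+1)
   (word_count N n i j)%:R * (z ^+ i * z ^+ j)).
  rewrite /= /word_count.
  under [RHS]eq_bigr => i _ do
    under eq_bigr => j _ do rewrite natr_sum big_distrl /=.
  under [RHS]eq_bigr => i _ do rewrite exchange_big /=.
  rewrite exchange_big /=; apply: eq_bigr => w _.
  rewrite num_fixed_sign.
  have le := fixed_sign_le w.
  have lti : (fixed_sign w false < n.+1)%N by lia.
  have ltj : (fixed_sign w true < (n - Ordinal lti).+1)%N by rewrite /=; lia.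
  rewrite (bigD1 (Ordinal lti)) //= (bigD1 (Ordinal ltj)) //= !eqxx mul1r exprD.
  rewrite !big1 ?addr0 // => [i|j] ne.
    rewrite big1 // => j _; case: eqP => e; last by rewrite mul0r.
    by case/eqP: ne; apply/val_inj.
  case: eqP => e; last by rewrite andbF mul0r.
  by case/eqP: ne; apply/val_inj.
apply: eq_bigr => i _; rewrite fps_coefM big_distrr /=; apply: eq_bigr => j _.
have {1}-> : n = (i + (j + (n - i - j)))%N by have := ltn_ord i; have := ltn_ord j; lia.
by rewrite word_countE !lettersE !natrM; ring.
Qed.

Lemma inv_1subM a : 1 / (1 - fpsC a * fpsX R) = FPS (fun n => a ^+ n).
Proof.
apply: (mulIr (unit_1subM (fpsC a))); rewrite divrK ?unit_1subM //.
apply/fpsP => n; rewrite mulrC mulrBl mul1r -mulrA.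
rewrite fps_coefD fps_coefN coef_fpsCM coef_fpsXM.
by rewrite fps_coef1; case: n => [|n] /=; rewrite ?mulr0 ?subr0 // exprS subrr.
Qed.

Lemma inv_1subX : 1 / (1 - fpsX R) = FPS (fun=> 1).
Proof.
have := inv_1subM 1; rewrite rmorph1 [1 * fpsX R]mul1r => ->.
by apply/fpsP => n; rewrite /= expr1n.
Qed.

Lemma word_series1 : word_series 1 = 1 / (1 - fpsC N%:R * fpsX R).
Proof.
rewrite inv_1subM; apply/fpsP => n /=.
under eq_bigr => w _ do rewrite expr1n.
by rewrite sumr_const card_ffun !card_ord natrX.
Qed.

Lemma cancel_factors (S : comUnitRingType) (p q f : S) :
  p \is a GRing.unit -> q \is a GRing.unit -> f = p / q * (p^-1 * (q * f)).
Proof. by move=> Up Uq; rewrite -[p / q * _]mulrA [q^-1 * _]mulrCA mulKr // mulVKr. Qed.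

(** The series of fixed-point-free words does not involve z, so the value at
    z = 1, where every word has weight 1, determines it. *)
Theorem word_seriesE z :
  word_series z = (1 + fpsC z * fpsX R) ^+ N./2 / (1 - fpsC z * fpsX R) ^+ uphalf N
    * ((1 - fpsX R) ^+ uphalf N / (1 + fpsX R) ^+ N./2)
    / (1 - N%:R * fpsX R).
Proof.
have inv_ms y : multiset_series (uphalf N) y = ((1 - fpsC y * fpsX R) ^+ uphalf N)^-1.
  apply: (mulIr (unitrX (uphalf N) (unit_1subM (fpsC y)))).
  by rewrite multiset_seriesE mulVr // unitrX ?unit_1subM.
have := word_series1; rewrite !word_series_factor !inv_ms !binomial_seriesE.
rewrite rmorph1 rmorph_nat mul1r mul1r => H.
have U1 : (1 - fpsX R) ^+ uphalf N \is a GRing.unit.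
  by rewrite unitrX // -[fpsX R]mul1r unit_1subM.
have U2 : (1 + fpsX R) ^+ N./2 \is a GRing.unit.
  by rewrite unitrX // -[fpsX R]mul1r unit_1addM.
have -> : fixfree_series
    = (1 - fpsX R) ^+ uphalf N / (1 + fpsX R) ^+ N./2 / (1 - N%:R * fpsX R).
  by rewrite -H; exact: cancel_factors.
by rewrite mulrCA !mulrA.
Qed.
End Series.

(** * From words to permutations *)

Section Chains.

(** Neighbours may carry the same letter only if the step between them has the
    direction of the block of that letter; d = true stands for an ascent. *)
Definition allowed (d : bool) (a b : nat) : bool :=
  (a < b) || (a == b) && (d == ~~ odd a).

(** The starting value a comes before the list; with a = 0 and e 0 = true it
    puts no constraint on the first letter. *)
Fixpoint chain (e : nat -> bool) (a : nat) (l : seq nat) : bool :=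
  if l is b :: l' then allowed (e 0) a b && chain (fun i => e i.+1) b l' else true.

Lemma chainP e a l :
  reflect (forall i, i < size l -> allowed (e i) (nth 0 (a :: l) i) (nth 0 l i))
          (chain e a l).
Proof.
elim: l e a => [|b l IH] e a /=; first by constructor.
apply: (iffP andP) => [[ab /IH H] [|i] //|H]; first exact: H.
by split; [apply: (H 0)|apply/IH => i; apply: (H i.+1)].
Qed.

Variable N : nat.

Definition reading n (f : {ffun 'I_n -> 'I_N}) : seq nat :=
  [seq val (f i) | i <- enum 'I_n].

Lemma nth_reading n (f : {ffun 'I_n -> 'I_N}) (i : 'I_n) : nth 0 (reading f) i = f i.
Proof. by rewrite (nth_map i) ?size_enum_ord // nth_ord_enum. Qed.

Definition chain_count n e a : nat :=
  \sum_(f : {ffun 'I_n -> 'I_N}) chain e a (reading f).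

Lemma chain_count0 e a : chain_count 0 e a = 1.
Proof.
rewrite /chain_count; under eq_bigr => f _.
  rewrite /reading (size0nil (size_enum_ord 0)) /=; over.
by rewrite sum1_card card_ffun !card_ord.
Qed.

Lemma chain_countS n e a :
  chain_count n.+1 e a
  = \sum_(c : 'I_N) allowed (e 0) a c * chain_count n (fun i => e i.+1) c.
Proof.
rewrite /chain_count (sum_ins ord0); apply: eq_bigr => c _.
rewrite big_distrr; apply: eq_bigr => w _ /=.
rewrite {1}/reading enum_ordSl /= ins_at -map_comp.
rewrite (@eq_map _ _ _ (val \o w)) ?mulnb //.
by move=> u /=; rewrite ins_lift.
Qed.
End Chains.

Section Sorting.
Variables (N n : nat).
Implicit Types (w : {ffun 'I_n.+1 -> 'I_N}) (s : 'S_n.+1).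

(** Direction of the step that ends at position i; the value at 0 is the virtual
    initial ascent. *)
Definition ascent s (i : nat) : bool :=
  if i is j.+1 then s (inord j) < s (inord j.+1) else true.

Definition sorts w s : bool := [forall i, rank w (s i) == i].

(** The order is total, so it is enough to compare neighbours; and a strictly
    increasing map from [0, n] to itself is the identity. *)
Lemma sorts_chain w s :
  sorts w s = chain (ascent s) 0 (reading [ffun i => w (s i)]).
Proof.
have nthE i : i < n.+1 -> nth 0 (reading [ffun i => w (s i)]) i = w (s (inord i)).
  by move=> lt; rewrite -{1}(inordK lt) nth_reading ffunE.
have allowedE i : i.+1 < n.+1 ->
    allowed (ascent s i.+1) (w (s (inord i))) (w (s (inord i.+1)))
    = (rank w (s (inord i)) < rank w (s (inord i.+1))).
  move=> lt; rewrite -precE /prec /allowed /= -val_eqE /=.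
  have : s (inord i) != s (inord i.+1).
    rewrite (inj_eq perm_inj) -val_eqE /= !inordK //; lia.
  by rewrite -val_eqE /= => neq; case: eqP => [->|]; case: odd; lia.
apply/forallP/chainP; rewrite size_map size_enum_ord.
  move=> H [|i] lt; first by rewrite /allowed /=; lia.
  rewrite -[nth _ (_ :: _) _]/(nth 0 (reading _) i) !nthE ?allowedE //; last by lia.
  by rewrite (eqP (H _)) (eqP (H _)) !inordK //; lia.
move=> H; pose g i := rank w (s (inord i)).
have gS i : i.+1 < n.+1 -> g i < g i.+1.
  move=> lt; have := H i.+1 lt.
  by rewrite -[nth _ (_ :: _) _]/(nth 0 (reading _) i) !nthE ?allowedE //; lia.
have ge_g i : i < n.+1 -> i <= g i.
  by elim: i => // i IH lt; have := gS i lt; have := IH (ltnW lt); lia.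
have le_g k : k < n.+1 -> g (n - k) <= n - k.
  elim: k => [_|k IH lt]; first by rewrite subn0; have := rank_lt w (s (inord n)).
  have := gS (n - k.+1); have := IH (ltnW lt).
  by rewrite -subSn // subSS; lia.
move=> i; have := ge_g i (ltn_ord i); have := le_g (n - i).
by rewrite /g subKn ?leq_ord // inord_val; lia.
Qed.

Definition rank_perm w : 'S_n.+1 := perm
  (fun u v (e : Ordinal (rank_lt w u) = Ordinal (rank_lt w v)) =>
     rank_inj (congr1 val e)).

Lemma sorts_rank_perm w s : sorts w s = (s == (rank_perm w)^-1)%g.
Proof.
apply/forallP/eqP => [H|-> i].
  apply/permP => i; apply: (@perm_inj _ (rank_perm w)).
  by rewrite permKV; apply: val_inj; rewrite permE /= (eqP (H i)).
by rewrite -{2}(permKV (rank_perm w) i) [X in _ == val X]permE.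
Qed.

Lemma fixpt_rank_perm w : fixpt (rank_perm w)^-1%g = num_fixed w.
Proof.
rewrite /fixpt -sum1_card big_mkcond; apply: eq_bigr => i _.
rewrite inE (canF_eq (permKV _)) eq_sym -val_eqE permE /=.
by case: eqP.
Qed.

Local Open Scope ring_scope.

(** A word is sorted by exactly one permutation, and for a given s the words
    sorted by s correspond to the admissible f through f i = w (s i). *)
Lemma sum_words_perms (R : pzSemiRingType) (z : R) :
  \sum_(w : {ffun 'I_n.+1 -> 'I_N}) z ^+ num_fixed w
  = \sum_(s : 'S_n.+1) (chain_count N n.+1 (ascent s) 0)%:R * z ^+ fixpt s.
Proof.
transitivity (\sum_(s : 'S_n.+1) \sum_(w : {ffun 'I_n.+1 -> 'I_N})
    (sorts w s)%:R * z ^+ fixpt s).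
  rewrite exchange_big; apply: eq_bigr => w _ /=.
  rewrite (bigD1 (rank_perm w)^-1%g) //= big1 => [|s]; rewrite sorts_rank_perm.
    by rewrite eqxx mul1r addr0 fixpt_rank_perm.
  by move/negPf->; rewrite mul0r.
apply: eq_bigr => s _; rewrite -big_distrl /= -natr_sum; congr (_%:R * _).
rewrite /chain_count [RHS](reindex (fun w => [ffun i => w (s i)])) /=.
  by apply: eq_bigr => w _; rewrite sorts_chain.
exists (fun f : {ffun _ -> _} => [ffun v => f ((s^-1)%g v)]) => f _;
  by apply/ffunP => v; rewrite !ffunE ?permK ?permKV.
Qed.
End Sorting.

Section Transfer.
Local Open Scope ring_scope.
Variable R : comUnitRingType.
Local Notation X := (fpsX R).

Definition geom2 : fps R := FPS (fun m => (~~ odd m)%:R).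
Definition tgeom : fps R := FPS (fun m => (0 < m)%N%:R).

Lemma geom2E : geom2 * (1 - X ^+ 2) = 1.
Proof.
rewrite mulrBr mulr1 [_ * X ^+ 2]mulrC expr2 -mulrA; apply/fpsP => -[|[|m]].
- by rewrite fps_coefD fps_coefN coef_fpsXM subr0.
- by rewrite fps_coefD fps_coefN !coef_fpsXM subr0.
- by rewrite fps_coefD fps_coefN !coef_fpsXM /= negbK subrr.
Qed.

Lemma tgeomE : tgeom * (1 - X) = X.
Proof.
rewrite mulrBr mulr1 mulrC; apply/fpsP => -[|[|m]];
by rewrite fps_coefD fps_coefN coef_fpsXM /= ?subr0 ?subrr.
Qed.

(** One step of the transfer matrix.  By translation invariance the count of
    chains that start at c, with values below c + M, depends on c only through
    its parity; A packages this dependence as series in M.  The next letter is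
    a + m with m of either parity, and m = 0 is possible exactly when the
    parity of a matches the direction. *)
Lemma chain_count_step n (e : nat -> bool) a M (A : bool -> fps R) :
  (forall c M,
     (chain_count (c + M) n (fun i => e i.+1) c * (0 < M))%:R = A (odd c) M) ->
  (chain_count (a + M) n.+1 e a * (0 < M))%:R
  = (geom2 * (if e 0%N == ~~ odd a then A (odd a) + X * A (~~ odd a)
              else X * (X * A (odd a) + A (~~ odd a)))) M.
Proof.
move=> HA.
pose evens : fps R := FPS (fun m => (allowed (e 0%N) a (a + m) && ~~ odd m)%:R).
pose odds : fps R := FPS (fun m => (odd m)%:R).
have oddsE : odds = X * geom2.
  by apply/fpsP => -[|m]; rewrite coef_fpsXM //= negbK.
have evensE : evens = if e 0%N == ~~ odd a then geom2 else X * (X * geom2).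
  have [ea|ne] := eqVneq (e 0%N); apply/fpsP => m.
    rewrite /= /allowed ea eqxx andbT.
    by case: m => [|m]; congr (_%:R); rewrite ?addn0 ?eqxx ?orbT //; lia.
  rewrite [LHS]/= /allowed (negPf ne) andbF orbF.
  case: m => [|[|m]]; rewrite !coef_fpsXM ?addn0 ?ltnn ?andbF //=.
  by rewrite negbK; congr (_%:R); lia.
transitivity ((evens * A (odd a) + odds * A (~~ odd a)) M); last first.
  by rewrite oddsE evensE; case: ifP => _; congr (fps_coef _ _); ring.
rewrite fps_coefD !fps_coefM -big_split /= chain_countS big_split_ord /=.
rewrite big1 ?add0n => [|c _]; last first.
  have := ltn_ord c; rewrite /allowed /=; case: ltngtP => //; lia.
rewrite big_ord_recr /= subnn.
have A0 b : A b 0%N = 0.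
  by case: b; [have := HA 1%N 0%N|have := HA 0%N 0%N]; rewrite muln0 => <-.
rewrite !A0 !mulr0 !addr0 big_distrl /= natr_sum; apply: eq_bigr => m _.
have -> : (0 < M)%N = true by have := ltn_ord m; lia.
have := HA (a + m)%N (M - m)%N.
rewrite -addnA subnKC; last exact: ltnW.
have -> : (0 < M - m)%N by have := ltn_ord m; lia.
rewrite !muln1 natrM => ->; rewrite oddD.
case om: (odd m) => /=; rewrite ?addbT ?addbF ?andbT ?andbF ?mul0r ?addr0 ?add0r //.
rewrite /allowed.
have -> : (a < a + m)%N || ((a == a + m)%N && (e 0%N == ~~ odd a)) = true.
  by case: (nat_of_ord m) om => [|k] //; lia.
by rewrite mul1r.
Qed.

Definition changes n (e : nat -> bool) : nat := (\sum_(i < n) (e i != e i.+1))%N.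

Lemma changes_le n e : (changes n e <= n)%N.
Proof.
rewrite -[X in (_ <= X)%N]card_ord -sum1_card; apply: leq_sum => i _.
by case: (_ != _).
Qed.

(** The factors are: t/(1 - t) for the bound N, 1 + t for the two parities of
    the last letter, 1 + t^2 for a repeated and 2t for a changed direction, and
    1/(1 - t^2) for each of the n + 1 steps. *)
Definition chain_series n m : fps R :=
  tgeom * (1 + X) * (1 + X ^+ 2) ^+ (n - m) * (2%:R * X) ^+ m * geom2 ^+ n.+1.

(** Before a step, the series for the two parities of the current letter are in
    the ratio 1 : t, the parity that matches the direction of the step coming
    first.  A step in the same direction as the next one therefore gives
    1 + t * t, and otherwise t + t: the transfer matrix acts by scalars. *)
Lemma chain_count_series n e a M :
  (chain_count (a + M) n.+1 e a * (0 < M))%:R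
  = ((if e 0%N == ~~ odd a then 1 else X) * chain_series n (changes n e)) M.
Proof.
elim: n e a M => [|n IH] e a M.
  rewrite (@chain_count_step _ _ _ _ (fun=> tgeom)) => [|c K].
    congr (fps_coef _ _); rewrite /chain_series /changes big_ord0 !expr0 expr1.
    by case: ifP => _; ring.
  by rewrite chain_count0 mul1n.
rewrite (@chain_count_step _ _ _ _
  (fun b => (if e 1%N == ~~ b then 1 else X)
            * chain_series n (changes n (fun i => e i.+1)))).
  congr (fps_coef _ _); rewrite [changes n.+1 e]big_ord_recl /=.
  rewrite -[X in chain_series n.+1 (_ + X)]/(changes n (fun i => e i.+1)).
  have := changes_le n (fun i => e i.+1); move: (changes n _) => m le.
  rewrite negbK /chain_series; case: (e 0%N) (e 1%N) (odd a) => [] [] [] /=;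
  rewrite ?add0n ?add1n ?subSS ?subSn // ?exprS; ring.
by move=> c K; rewrite IH.
Qed.
End Transfer.

(** * Up-down runs and changes of direction *)

Section UpDownRuns.
Variables (n : nat) (s : 'S_n.+1).
Implicit Types I J : 'I_n.+1 * 'I_n.+1.

Definition steps_equal (d : bool) (a b : nat) : Prop :=
  forall j, a <= j < b -> ascent s j.+1 = d.

Lemma monotone_onP I :
  reflect (I.1 <= I.2 /\ exists d, steps_equal d I.1 I.2) (monotone_on s I).
Proof.
have chain_trans (r : rel nat) (a b : nat) : transitive r -> a < b ->
    (forall j, a <= j < b -> r (s (inord j)) (s (inord j.+1))) ->
    r (s (inord a)) (s (inord b)).
  move=> tr; elim: b => // b IH; rewrite ltnS leq_eqVlt => /orP[/eqP <- H|lt H].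
    by apply: H; rewrite leqnn ltnSn.
  apply: tr (H b _); last by rewrite ltnS leqnn ltnW.
  by apply: IH => // j jb; apply: H; lia.
have step_neq j : j < n -> val (s (inord j)) != val (s (inord j.+1)).
  by move=> lt; rewrite val_eqE (inj_eq perm_inj) -val_eqE /= !inordK //; lia.
apply: (iffP andP) => -[le H]; split=> //.
  have lt j : I.1 <= j < I.2 -> j < n by have := ltn_ord I.2; lia.
  case/orP: H => /forallP H; [exists true|exists false] => j jI;
    have /forallP/(_ (inord j.+1))/implyP := H (inord j);
    rewrite !inordK ?ltnS ?lt ?(ltnW (lt _ jI)) //= => K.
    by apply: K; lia.
  by apply/negbTE; rewrite -leqNgt ltnW // K //; lia.
have [[] eqs] := H; apply/orP; [left|right]; apply/forallP => a; apply/forallP => b;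
  apply/implyP => /and3P[Ia ab bI]; rewrite -(inord_val a) -(inord_val b).
  by apply: (chain_trans ltn a b ltn_trans ab) => j jab; apply: eqs; lia.
apply: (chain_trans (fun x y => y < x) a b _ ab) => [y x z xy yz|j jab].
  exact: ltn_trans yz xy.
have lt : j < n by have := ltn_ord b; lia.
have desc : ascent s j.+1 = false by apply: eqs; lia.
by have := step_neq j lt; rewrite neq_ltn [_ < _]desc.
Qed.

Lemma birunP I :
  reflect (monotone_on s I /\
           forall J, J.1 <= I.1 -> I.2 <= J.2 -> monotone_on s J -> J = I)
          (birun s I).
Proof.
apply: (iffP andP) => -[mI H]; split=> //.
  by move=> J l r mJ; apply/eqP; move/forallP/(_ J)/implyP: H; apply; apply/and3P.
by apply/forallP => J; apply/implyP => /and3P[l r mJ]; apply/eqP; apply: H.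
Qed.

Lemma initial_descentE : initial_descent s = (0 < n) && ~~ ascent s 1.
Proof.
apply/existsP/andP => [[a /existsP[b /and3P[/eqP a0 /eqP b1 lt]]]|[n0 d]].
  split; first by have := ltn_ord b; lia.
  by move: lt; rewrite /= -(inord_val b) -(inord_val a) a0 b1 -leqNgt => /ltnW.
exists ord0; apply/existsP; exists (inord 1); rewrite inordK //= ltn_neqAle.
rewrite leqNgt (_ : ord0 = inord 0); last by apply/val_inj; rewrite /= inordK.
rewrite d andbT val_eqE (inj_eq perm_inj) -val_eqE /= !inordK //.
Qed.

(** Runs are indexed by their last position because the single-letter run at the
    start is then one more change of direction, from the virtual ascent to an
    initial descent. *)
Definition run_end (i : 'I_n.+1) : bool :=
  (i == n :> nat) || (ascent s i != ascent s i.+1).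

Lemma monotone_step (a b : 'I_n.+1) : b = a.+1 :> nat -> monotone_on s (a, b).
Proof.
move=> e; apply/monotone_onP; split; first by rewrite /=; lia.
by exists (ascent s a.+1) => j /= ab; congr (ascent s _.+1); lia.
Qed.

Lemma run_end_updown_run I : updown_run s I -> run_end I.2.
Proof.
rewrite /run_end.
case/orP=> [/birunP[/monotone_onP[le [d eqs]] maxI]|/and3P[_ /eqP -> ]]; last first.
  by rewrite initial_descentE => /andP[n0 /negPf->]; rewrite orbT.
case: eqP => //= /eqP nn; have lt : I.2 < n by have := ltn_ord I.2; lia.
have Ilt : I.1 < I.2.
  rewrite ltn_neqAle le andbT; apply/eqP => e.
  have := maxI (I.1, inord I.2.+1); rewrite /= inordK // => K.
  have := K (leqnn _) (leqnSn _) (monotone_step _).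
  rewrite inordK // e => /(_ erefl) [] /(congr1 (fun J => val J.2)) /=.
  by rewrite inordK //; lia.
apply/negP => /eqP step.
have := maxI (I.1, inord I.2.+1); rewrite /= inordK // => K.
have : (I.1, inord I.2.+1) = I.
  apply: K => //; apply/monotone_onP; rewrite /= inordK //; split; first by lia.
  exists d => j jI; have [e|ne] := eqVneq j I.2; last by apply: eqs; lia.
  rewrite e; apply: (etrans (esym step)); rewrite -(eqs I.2.-1); last by lia.
  by congr (ascent s _); lia.
move/(congr1 (fun J => val J.2)); rewrite /= inordK //; lia.
Qed.

Lemma birun_same_end I J : birun s I -> birun s J -> I.2 = J.2 -> I = J.
Proof.
move=> /birunP[mI maxI] /birunP[mJ maxJ] e.
have [le|lt] := leqP I.1 J.1; first by apply: maxJ; rewrite ?e.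
by apply/esym; apply: maxI; rewrite ?e // ltnW.
Qed.

Lemma updown_run_same_end I J : updown_run s I -> updown_run s J -> I.2 = J.2 -> I = J.
Proof.
have init_birun (K L : 'I_n.+1 * 'I_n.+1) :
    [&& K.1 == 0 :> nat, K.2 == 0 :> nat & initial_descent s] ->
    birun s L -> K.2 = L.2 -> K = L.
  case: K L => [a b] [a' b'] /= /and3P[/eqP a0 /eqP b0 _].
  move=> /birunP[/monotone_onP[/= le _] _] e.
  by congr pair => //; apply: val_inj; rewrite /= a0; rewrite -e b0 in le; lia.
move=> /orP[bI|iI] /orP[bJ|iJ] e.
- exact: birun_same_end.
- by apply/esym/init_birun.
- exact: init_birun.
move: iI iJ => /and3P[/eqP I1 /eqP I2 _] /and3P[/eqP J1 /eqP J2 _].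
case: I J e I1 J1 {I2 J2} => [a b] [a' b'] /= -> a0 a0'.
by congr pair; apply: val_inj; rewrite /= a0 a0'.
Qed.

(** The run with a given last position i > 0 extends as far to the left as
    monotonicity permits; the change of direction at i stops it on the right. *)
Lemma updown_run_run_end i : run_end i -> exists2 I, updown_run s I & i = I.2.
Proof.
have [i0|i0] := posnP i.
  have [n0 _|n0] := posnP n.
    exists (i, i) => //; apply/orP; left; apply/birunP; split.
      by apply/monotone_onP; split=> //; exists true => j /=; lia.
    move=> [a b] _ _ _; congr pair; apply: val_inj; rewrite /=;
    [have := ltn_ord a|have := ltn_ord b]; lia.
  rewrite /run_end i0 => H; exists (i, i) => //; apply/orP; right.
  rewrite initial_descentE n0 i0 /=; move: H; rewrite /=; case: (_ < _) => //=; lia.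
move=> ei; have lti := ltn_ord i; pose P (a : 'I_n.+1) := monotone_on s (a, i).
have mpred : P (inord i.-1).
  by apply: monotone_step; rewrite inordK; lia.
case: (arg_minnP (fun a => val a) mpred) => a Pa mina.
exists (a, i) => //; apply/orP; left; apply/birunP; split=> // -[b c] /= ba ic mJ.
have := mina _ mpred; rewrite /= inordK => [ai|]; last by lia.
have ci : c = i.
  apply: val_inj; rewrite /=; apply/eqP; rewrite eqn_leq ic andbT leqNgt.
  apply/negP => lt.
  case/orP: ei => [/eqP e|/negP[]]; first by have := ltn_ord c; lia.
  have /monotone_onP[_ [d eqs]] := mJ; rewrite /= in eqs.
  by have -> : ascent s i = ascent s i.-1.+1; [congr ascent; lia|rewrite !eqs //; lia].
rewrite ci in mJ *; congr pair; apply: val_inj; apply/eqP; rewrite eqn_leq ba /=.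
exact: mina.
Qed.

Theorem udr_changes : udr s = (changes n (ascent s)).+1.
Proof.
transitivity #|[set i | run_end i]|.
  rewrite /udr -(card_in_imset (f := fun I => I.2)) => [|I J]; last first.
    by rewrite !inE; apply: updown_run_same_end.
  congr #|pred_of_set _|; apply/setP => i; rewrite inE; apply/imsetP/idP.
    by move=> [I]; rewrite inE => uI ->; apply: run_end_updown_run.
  by move/updown_run_run_end => [I uI ->]; exists I; rewrite ?inE.
rewrite -sum1_card big_mkcond big_ord_recr /= inE /run_end eqxx /= addn1; congr _.+1.
apply: eq_bigr => i _; rewrite inE /=; have /ltn_eqF -> := ltn_ord i.
by case: (_ != _).
Qed.
End UpDownRuns.

(** * Assembling the bivariate series *)

Local Open Scope ring_scope.

Lemma fpsC_div (S : comUnitRingType) (a b : S) : b \is a GRing.unit ->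
  fpsC (a / b) = fpsC a / fpsC b.
Proof. by move=> Ub; rewrite rmorphM rmorphV. Qed.

Lemma coef_fpsX_exp (S : comNzRingType) m n : (fpsX S ^+ m) n = (n == m)%:R.
Proof.
elim: m n => [|m IH] n; first by rewrite fps_coef1.
rewrite exprS fps_coefM big_ord_recl /= mul0r add0r.
case: n => [|n]; first by rewrite big_ord0.
rewrite big_ord_recl mul1r subn1 big1 => [|i _]; last by rewrite mul0r.
by rewrite addr0 IH.
Qed.

Section Lift.
Variable R : comUnitRingType.

(** The series in x alone, inside the series in x and t. *)
Definition lift_series (f : fps R) : fps (fps R) := FPS (fun n => fpsC (f n)).

Fact lift_series_is_zmod_morphism : zmod_morphism lift_series.
Proof. by move=> f g; apply/fpsP => n; rewrite /= rmorphB. Qed.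

Fact lift_series_is_monoid_morphism : monoid_morphism lift_series.
Proof.
split=> [|f g]; apply/fpsP => n.
  by rewrite fps_coef1; case: n => [|n]; rewrite /= ?rmorph1 ?rmorph0.
by rewrite fps_coefM /= rmorph_sum; apply: eq_bigr => i _; rewrite rmorphM.
Qed.

HB.instance Definition _ :=
  GRing.isZmodMorphism.Build _ _ lift_series lift_series_is_zmod_morphism.
HB.instance Definition _ :=
  GRing.isMonoidMorphism.Build _ _ lift_series lift_series_is_monoid_morphism.

Lemma lift_seriesC a : lift_series (fpsC a) = fps2C a.
Proof. by apply/fpsP => -[|n] //=; rewrite rmorph0. Qed.

Lemma lift_seriesX : lift_series (fpsX R) = xvar R.
Proof. by apply/fpsP => n; rewrite /= rmorph_nat. Qed.

Lemma lift_series_frac a b c d e :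
  b \is a GRing.unit -> d \is a GRing.unit -> e \is a GRing.unit ->
  lift_series (a / b * (c / d) / e)
  = lift_series a / lift_series b * (lift_series c / lift_series d) / lift_series e.
Proof. by move=> Ub Ud Ue; rewrite !rmorphM !rmorphV. Qed.

Lemma coef_lift_tvar f m i j :
  (lift_series f * tvar R ^+ m) i j = f i * (j == m)%:R.
Proof.
rewrite -rmorphXn mulrC coef_fpsCM -[lift_series f i]/(fpsC (f i)).
by rewrite mulrC coef_fpsCM coef_fpsX_exp.
Qed.

Lemma fps2_evalE (I : Type) (r : seq I) (c : I -> R) (d : I -> nat) u :
  fps2_eval (\sum_(i <- r) (c i)%:P * 'X^(d i)) u
  = \sum_(i <- r) fps2C (c i) * u ^+ d i.
Proof.
rewrite /fps2_eval -[map_poly _]/(map_poly (@fpsC (fps R) \o @fpsC R)).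
rewrite rmorph_sum horner_sum; apply: eq_bigr => i _.
by rewrite rmorphM /= map_polyC map_polyXn hornerCM hornerXn.
Qed.
End Lift.

Lemma eq_fps2_sum (R : zmodType) m (F G : nat -> fps (fps R)) S :
  F =1 G -> fps2_sum m F S -> fps2_sum m G S.
Proof.
move=> FG sF i j; have [M H] := sF i j; exists M => n le.
by rewrite -(H n le); congr (fps_coef (fps_coef _ _) _); apply: eq_bigr => k _.
Qed.

Lemma fps2_sum_xpow (R : comUnitRingType) (W : nat -> fps R) :
  fps2_sum 1 (fun n => fpsC (W n) * xvar R ^+ n)
    (FPS (fun n => if (0 < n)%N then W n else 0)).
Proof.
move=> i j; exists i.+1 => n le; rewrite fps_coef_sum; congr (fps_coef _ _).
under eq_bigr => k _ do rewrite coef_fpsCM coef_fpsX_exp mulr_natr mulrb.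
rewrite -big_mkcond /= (eq_bigl (fun k => k == i)) => [|k]; last exact: eq_sym.
by rewrite big_nat1_eq le andbT.
Qed.

Lemma fps2_sum_tpow (R : comUnitRingType) (f : nat -> fps R) :
  fps2_sum 0 (fun k => lift_series (f (2 * k)%N) * tvar R ^+ (2 * k)
                     + lift_series (f (2 * k + 1)%N) * tvar R ^+ (2 * k + 1))
    (FPS (fun i => FPS (fun j => f j i))).
Proof.
move=> i j; exists j.+1 => n le; rewrite !fps_coef_sum.
under eq_bigr => k _ do rewrite fps_coefD !coef_lift_tvar.
transitivity (if (j < 2 * n)%N then f j i else 0); last by rewrite ifT //; lia.
elim: n {le} => [|n IH]; first by rewrite big_geq.
rewrite big_nat_recr //= IH.
have [->|n0] := eqVneq j (2 * n)%N.
  rewrite ltnn mulr1 (_ : (_ == _ + 1)%N = false) ?mulr0 ?ifT; first by ring.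
    lia.
  lia.
have [->|n1] := eqVneq j (2 * n + 1)%N.
  rewrite ifF ?ifT; first by rewrite /= mulr0 mulr1 !add0r.
    lia.
  lia.
by rewrite !mulr0 !addr0; congr (if _ then _ else _); lia.
Qed.

Section Assembly.
Variables (R : comUnitRingType) (z : R).
Hypothesis unit2 : (2%:R : R) \is a GRing.unit.
Local Notation X := (fpsX R).

Lemma unit_1subX : 1 - X \is a GRing.unit.
Proof. by rewrite -[X]mul1r unit_1subM. Qed.

Lemma unit_1addX : 1 + X \is a GRing.unit.
Proof. by rewrite -[X]mul1r unit_1addM. Qed.

Lemma unit_1subX2 : 1 - X ^+ 2 \is a GRing.unit.
Proof. exact: unit_1subM. Qed.

Lemma unit_1addX2 : 1 + X ^+ 2 \is a GRing.unit.
Proof. exact: unit_1addM. Qed.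

Lemma unit_denominator n : 2%:R * (1 - X) ^+ 2 * (1 - X ^+ 2) ^+ n \is a GRing.unit.
Proof.
rewrite !unitrM !unitrX ?unit_1subX ?unit_1subX2 // !andbT.
by rewrite -(rmorph_nat (@fpsC R)) rmorph_unit.
Qed.

(** Multiplying out the denominators leaves the relations tgeom * (1 - X) = X and
    geom2 * (1 - X^2) = 1. *)
Lemma chain_seriesE n m : (m <= n)%N ->
  (1 + X ^+ 2) ^+ n.+1 / (2%:R * (1 - X) ^+ 2 * (1 - X ^+ 2) ^+ n)
    * (2%:R * X / (1 + X ^+ 2)) ^+ m.+1 = chain_series R n m.
Proof.
move=> le; apply: (mulIr (unit_denominator n)).
rewrite mulrAC divrK ?unit_denominator // expr_div_n mulrCA.
have -> : n.+1 = (n - m + m.+1)%N by lia.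
rewrite exprD mulrK ?unitrX ?unit_1addX2 //.
rewrite /chain_series [geom2 R ^+ _]exprS.
have EE : geom2 R ^+ n * (1 - X ^+ 2) ^+ n = 1 by rewrite -exprMn geom2E expr1n.
rewrite exprS.
transitivity ((1 + X ^+ 2) ^+ (n - m) * (2%:R * X) ^+ m * 2%:R * (tgeom R * (1 - X))
  * (geom2 R * (1 - X ^+ 2)) * (geom2 R ^+ n * (1 - X ^+ 2) ^+ n)); last by ring.
by rewrite tgeomE geom2E EE; ring.
Qed.

Variable P : nat -> {poly R}.
Hypothesis PE : forall n, P n = \sum_(s : 'S_n) (z ^+ fixpt s)%:P * 'X^(udr s).

Definition udr_fix_coef n : fps R :=
  (1 + X ^+ 2) ^+ n / (2%:R * (1 - X) ^+ 2 * (1 - X ^+ 2) ^+ n.-1)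
  * \sum_(s : 'S_n) fpsC (z ^+ fixpt s) * (2%:R * X / (1 + X ^+ 2)) ^+ udr s.

(** Both sides sum z^fix over the pairs (s, f), grouped by s on the left and
    by the word on the right. *)
Lemma udr_fix_coefE n N : udr_fix_coef n.+1 N = word_series N z n.+1.
Proof.
have -> : udr_fix_coef n.+1 = \sum_(s : 'S_n.+1)
    fpsC (z ^+ fixpt s) * chain_series R n (changes n (ascent s)).
  rewrite /udr_fix_coef big_distrr /=; apply: eq_bigr => s _.
  by rewrite [LHS]mulrCA udr_changes chain_seriesE ?changes_le.
rewrite fps_coef_sum [RHS]sum_words_perms; apply: eq_bigr => s _.
rewrite coef_fpsCM mulrC; congr (_ * _).
have : (chain_count N n.+1 (ascent s) 0 * (0 < N))%:R
    = (1 * chain_series R n (changes n (ascent s))) N.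
  exact: chain_count_series R n (ascent s) 0 N.
rewrite mul1r => <-.
case: N => [|N]; last by rewrite muln1.
by rewrite !chain_countS !big_ord0.
Qed.

Lemma udr_fix_termE n :
  let t := tvar R in
  (1 + t ^+ 2) ^+ n / (2%:R * (1 - t) ^+ 2 * (1 - t ^+ 2) ^+ n.-1)
    * fps2_eval (P n) (2%:R * t / (1 + t ^+ 2)) * xvar R ^+ n
  = fpsC (udr_fix_coef n) * xvar R ^+ n.
Proof.
move=> t; congr (_ * _); rewrite PE fps2_evalE rmorphM rmorph_sum /=.
rewrite fpsC_div; last exact: unit_denominator.
rewrite !(rmorphM, rmorphXn, rmorphD, rmorphN, rmorph1, rmorph_nat) /=.
congr (_ * _); apply: eq_bigr => s _; rewrite rmorphM; congr (_ * _).
rewrite [RHS]rmorphXn /=.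
rewrite fpsC_div; last exact: unit_1addX2.
by rewrite !(rmorphM, rmorphXn, rmorphD, rmorph1, rmorph_nat).
Qed.

Lemma two_letter_terms (S : comUnitRingType) (p q c d e f t T : S) k :
  q \is a GRing.unit ->
  p / q ^+ k * (c ^+ k / d) * T * (1 / e + c / q * (t / f))
  = p / q ^+ k * (c ^+ k / d) / e * T
    + p / (q * q ^+ k) * (c * c ^+ k / d) / f * (T * t).
Proof. by move=> Uq; rewrite (invrM Uq (unitrX _ Uq)); ring. Qed.

(** Two consecutive alphabet sizes make one term: 2k letters are k of each
    parity, and the additional letter of the alphabet of size 2k + 1 is even,
    which accounts for the factor (1 - x)/(1 - zx). *)
Lemma word_termE k :
  let x := xvar R in let t := tvar R in let y := fps2C z in
  (1 + y * x) ^+ k / (1 - y * x) ^+ k * ((1 - x) ^+ k / (1 + x) ^+ k) * t ^+ (2 * k)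
    * (1 / (1 - (2 * k)%:R * x)
       + (1 - x) / (1 - y * x) * (t / (1 - (2 * k + 1)%:R * x)))
  = lift_series (word_series (2 * k) z) * t ^+ (2 * k)
    + lift_series (word_series (2 * k + 1) z) * t ^+ (2 * k + 1).
Proof.
move=> x t y.
have Uz := unit_1subM (fpsC z).
have UN N : 1 - N%:R * X \is a GRing.unit by exact: unit_1subM.
have E N : lift_series (word_series N z)
    = (1 + y * x) ^+ N./2 / (1 - y * x) ^+ uphalf N
      * ((1 - x) ^+ uphalf N / (1 + x) ^+ N./2) / (1 - N%:R * x).
  rewrite word_seriesE.
  rewrite (lift_series_frac _ _ (unitrX _ Uz) (unitrX _ unit_1addX) (UN N)).
  by rewrite !(rmorphM, rmorphXn, rmorphD, rmorphN, rmorph1, rmorph_nat) /=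
             lift_seriesC lift_seriesX.
have [h0 h1 u0 u1] : [/\ (2 * k)./2 = k, (2 * k + 1)./2 = k,
    uphalf (2 * k) = k & uphalf (2 * k + 1) = k.+1]%N by split; lia.
have Uy : 1 - y * x \is a GRing.unit := unit_1subM y.
rewrite !E h0 h1 u0 u1 !exprS exprD expr1.
exact: two_letter_terms.
Qed.

(** With z in the coefficient ring, both parts of the final theorem are
    instances: z an indeterminate, and z = 0. *)
Theorem udr_fix_identity :
  let x := xvar R in let t := tvar R in let y := fps2C z in
  exists A B : fps (fps R),
  [/\ fps2_sum 1
        (fun n => (1 + t ^+ 2) ^+ n / (2%:R * (1 - t) ^+ 2 * (1 - t ^+ 2) ^+ n.-1)
                  * fps2_eval (P n) (2%:R * t / (1 + t ^+ 2)) * x ^+ n) A,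
      fps2_sum 0
        (fun k => (1 + y * x) ^+ k / (1 - y * x) ^+ k
                  * ((1 - x) ^+ k / (1 + x) ^+ k) * t ^+ (2 * k)
                  * (1 / (1 - (2 * k)%:R * x)
                     + (1 - x) / (1 - y * x) * (t / (1 - (2 * k + 1)%:R * x)))) B
    & 1 / (1 - t) + A = B].
Proof.
move=> x t y.
exists (FPS (fun n => if (0 < n)%N then udr_fix_coef n else 0)).
exists (FPS (fun i => FPS (fun j => word_series j z i))); split.
- apply: eq_fps2_sum (fps2_sum_xpow udr_fix_coef) => n.
  by rewrite -udr_fix_termE.
- apply: eq_fps2_sum (fps2_sum_tpow (fun N => word_series N z)) => k.
  by rewrite -word_termE.
have -> : 1 / (1 - t) = fpsC (1 / (1 - X)).
  rewrite fpsC_div; last exact: unit_1subX.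
  by rewrite rmorphB !rmorph1.
rewrite inv_1subX; apply/fpsP => i; apply/fpsP => j; rewrite !fps_coefD.
case: i => [|n]; last by rewrite [LHS]add0r udr_fix_coefE.
rewrite addr0 /= (eq_bigr (fun=> 1)) => [|w _].
  by rewrite sumr_const card_ffun !card_ord.
by rewrite /num_fixed big_ord0.
Qed.
End Assembly.

Lemma D_udrE n : D_udr n = \sum_(s : 'S_n) ((0 : rat) ^+ fixpt s)%:P * 'X^(udr s).
Proof.
rewrite /D_udr big_mkcond; apply: eq_bigr => s _; rewrite expr0n.
suff -> : derangement s = (fixpt s == 0)%N by case: eqP; rewrite ?mul1r ?mul0r.
rewrite /fixpt cards_eq0; apply/forallP/eqP => [H|H i].
  by apply/setP => i; rewrite !inE; apply/negbTE.
by have /setP/(_ i) := H; rewrite !inE => ->.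
Qed.

Theorem theorem6p10 :
  (let x := xvar {poly rat} in
   let t := tvar {poly rat} in
   let z := fps2C ('X : {poly rat}) in
   exists A B : fps (fps {poly rat}),
     [/\ fps2_sum 1
           (fun n => (1 + t ^+ 2) ^+ n
                     / (2%:R * (1 - t) ^+ 2 * (1 - t ^+ 2) ^+ n.-1)
                     * fps2_eval (P_udr_fix n) (2%:R * t / (1 + t ^+ 2))
                     * x ^+ n) A,
         fps2_sum 0
           (fun k => (1 + z * x) ^+ k / (1 - z * x) ^+ k
                     * ((1 - x) ^+ k / (1 + x) ^+ k)
                     * t ^+ (2 * k)
                     * (1 / (1 - (2 * k)%:R * x)
                        + (1 - x) / (1 - z * x)
                          * (t / (1 - (2 * k + 1)%:R * x)))) B
       & 1 / (1 - t) + A = B])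
  /\
  (let x := xvar rat in
   let t := tvar rat in
   exists A B : fps (fps rat),
     [/\ fps2_sum 1
           (fun n => (1 + t ^+ 2) ^+ n
                     / (2%:R * (1 - t) ^+ 2 * (1 - t ^+ 2) ^+ n.-1)
                     * fps2_eval (D_udr n) (2%:R * t / (1 + t ^+ 2))
                     * x ^+ n) A,
         fps2_sum 0
           (fun k => (1 - x) ^+ k / (1 + x) ^+ k
                     * t ^+ (2 * k)
                     * (1 / (1 - (2 * k)%:R * x)
                        + (1 - x) * t / (1 - (2 * k + 1)%:R * x))) B
       & 1 / (1 - t) + A = B]).
Proof.
split.
  apply: udr_fix_identity => //.
  by rewrite -(rmorph_nat (@polyC rat)) rmorph_unit.
move=> x t; have [//|A [B [sA sB AB]]] := @udr_fix_identity rat 0 _ D_udr D_udrE.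
exists A, B; split=> //; apply: eq_fps2_sum sB => k.
rewrite (_ : fps2C 0 = 0); last by rewrite /fps2C !rmorph0.
by rewrite mul0r !(subr0, addr0) expr1n !divr1 mul1r mulrA.
Qed.
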